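(* Let $(E,d)$ be a complete geodesic metric space with convex metric and curvature bounded below by $\kappa<0$. Suppose $A\in P_{b,cl}(E)$. Then the set \[\mathcal{W}_{min}=\left\{X\in P_{b,cl,cv}^A(E) : \min(A,X)\text{ is well-posed}\right\}\] is a dense $G_\delta$-set in $P_{b,cl,cv}^A(E)$ (with respect to the Pompeiu-Hausdorff distance).
   Context: Let $(E,d)$ be a metric space. A geodesic path from $x$ to $y$ is a map $c:[0,l]\to E$ with $c(0)=x$, $c(l)=y$ and $d(c(t),c(t'))=|t-t'|$ for all $t,t'\in[0,l]$; its image is a geodesic segment joining $x$ and $y$. $E$ is a geodesic space if every two points are joined by a geodesic path. A subset $X\subseteq E$ is convex if every geodesic segment joining two points of $X$ is contained in $X$. The metric of a geodesic space is convex if for any geodesic paths $c_1:[0,l_1]\to E$, $c_2:[0,l_2]\to E$ with $c_1(0)=c_2(0)$ one has $d(c_1(tl_1),c_2(tl_2))\le t\,d(c_1(l_1),c_2(l_2))$ for all $t\in[0,1]$. Curvature bounded below by $\kappa<0$: let $M^2_\kappa$ be the hyperbolic plane $\mathbb{H}^2$ with its distance multiplied by $1/\sqrt{-\kappa}$. A geodesic triangle $\Delta$ consists of three vertices $x_1,x_2,x_3\in E$ and three geodesic segments (edges), one joining each pair of vertices. A $\kappa$-comparison triangle is a geodesic triangle $\bar\Delta$ in $M^2_\kappa$ with vertices $\bar x_1,\bar x_2,\bar x_3$ such that $d(x_i,x_j)=d_{M^2_\kappa}(\bar x_i,\bar x_j)$ for all $i,j$ (it exists and is unique up to isometry). For a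 point $x$ on the edge $[x_i,x_j]$, the corresponding point $\bar x$ is the point of $[\bar x_i,\bar x_j]$ with $d_{M^2_\kappa}(\bar x,\bar x_i)=d(x,x_i)$. The geodesic space $E$ has curvature bounded below by $\kappa$ if for every geodesic triangle $\Delta$, every $\kappa$-comparison triangle $\bar\Delta$ and all $x,y\in\Delta$ one has $d(x,y)\ge d_{M^2_\kappa}(\bar x,\bar y)$ (reversed CAT$(\kappa)$ inequality). $P_{b,cl}(E)$ is the family of nonempty, bounded, closed subsets of $E$; $P_{b,cl,cv}(E)$ is the family of nonempty, bounded, closed, convex subsets of $E$. Both carry the Pompeiu-Hausdorff distance $h(X,Y)=\max\{\sup_{x\in X}\mathrm{dist}(x,Y),\sup_{y\in Y}\mathrm{dist}(y,X)\}$, where $\mathrm{dist}(z,X)=\inf_{x\in X}d(z,x)$. For $X,Y\in P_{b,cl}(E)$ put $\lambda_{XY}=\inf\{d(x,y):x\in X,y\in Y\}$. For the fixed set $A$, $\lambda_X=\lambda_{XA}$ and \[P_{b,cl,cv}^A(E)=\overline{\{X\in P_{b,cl,cv}(E):\lambda_X>0\}},\] the closure being taken in $(P_{b,cl,cv}(E),h)$; it is equipped with $h$. The problem $\min(X,Y)$ consists in finding $(x_0,y_0)\in X\times Y$ (a solution) with $d(x_0,y_0)=\lambda_{XY}$. A minimizing sequence is a sequence $(x_n,y_n)$ in $X\times Y$ with $d(x_n,y_n)\to\lambda_{XY}$. The problem $\min(X,Y)$ is well-posed if it has a unique solution $(x_0,y_0)$ and every minimizing sequence $(x_n,y_n)$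 satisfies $x_n\to x_0$ and $y_n\to y_0$. *)

(* Defs.v *)
From HB Require Import structures.
From mathcomp Require Import all_boot all_order all_algebra.
From mathcomp Require Import all_classical all_reals all_analysis borel_hierarchy.
From mathcomp Require Import lra.

Set Implicit Arguments.
Unset Strict Implicit.
Unset Printing Implicit Defensive.
Import Order.TTheory GRing.Theory Num.Theory.
Import numFieldNormedType.Exports.
Local Open Scope classical_set_scope.
Local Open Scope ring_scope.

(* Geodesics are defined for a bare distance function, so that the same
   definitions serve for a metric space and for the model planes. A path
   [0, l] -> T is a total function R -> T of which only the values on [0, l]
   matter. *)
Definition geodesic_path {R : realType} {T : Type} (d : T -> T -> R)
    (x y : T) (l : R) (c : R -> T) : Prop :=
  [/\ 0 <= l, c 0 = x, c l = y &
      {in `[0, l] &, forall t t' : R, d (c t) (c t') = `|t - t'|}].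

Definition geodesic_segment {R : realType} {T : Type} (d : T -> T -> R)
    (x y : T) (S : set T) : Prop :=
  exists l c, geodesic_path d x y l c /\ S = c @` `[0, l].

Definition geodesic_space {R : realType} (E : metricType R) : Prop :=
  forall x y : E, exists l c, geodesic_path mdist x y l c.

Definition geodesically_convex {R : realType} {E : metricType R}
    (X : set E) : Prop :=
  forall x y S, X x -> X y -> geodesic_segment mdist x y S -> S `<=` X.

Definition convex_metric {R : realType} (E : metricType R) : Prop :=
  forall (x y1 y2 : E) (l1 l2 : R) (c1 c2 : R -> E),
    geodesic_path mdist x y1 l1 c1 -> geodesic_path mdist x y2 l2 c2 ->
    forall t : R, 0 <= t <= 1 ->
      mdist (c1 (t * l1)) (c2 (t * l2)) <= t * mdist (c1 l1) (c2 l2).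

(* The condition [cauchy_cvg] of [completeType]; that structure and [cvg] cannot
   be used as such because they require E to be pointed. *)
Definition complete_space {R : realType} (E : metricType R) : Prop :=
  forall F : set_system E, ProperFilter F -> cauchy F ->
    exists x : E, F --> x.

(* The hyperbolic plane, in the hyperboloid model: the upper sheet of
   <u, u> = -1 for the Lorentz form <u, v> = u_x v_x + u_y v_y - u_z v_z,
   with cosh (d (u, v)) = - <u, v>. *)
Record hyperbolic_plane (R : realType) := HyperbolicPlane {
  hyp_x : R;
  hyp_y : R;
  hyp_z : R;
  hyp_form : hyp_x ^+ 2 + hyp_y ^+ 2 - hyp_z ^+ 2 = -1;
  hyp_z_gt0 : 0 < hyp_z }.

Definition lorentz {R : realType} (u v : hyperbolic_plane R) : R :=
  hyp_x u * hyp_x v + hyp_y u * hyp_y v - hyp_z u * hyp_z v.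

Definition arcosh {R : realType} (x : R) : R := ln (x + Num.sqrt (x ^+ 2 - 1)).

Definition hyp_dist {R : realType} (u v : hyperbolic_plane R) : R :=
  arcosh (- lorentz u v).

Definition model_dist {R : realType} (kappa : R) (u v : hyperbolic_plane R) :
  R := (Num.sqrt (- kappa))^-1 * hyp_dist u v.

(* The edge of index i joins the vertices i and i + 1 modulo 3. *)
Record geodesic_triangle {R : realType} {T : Type} (d : T -> T -> R) :=
  GeodesicTriangle {
    vertex : 'I_3 -> T;
    edge : 'I_3 -> set T;
    edgeP : forall i, geodesic_segment d (vertex i) (vertex (ordS i)) (edge i)
  }.

Definition comparison_triangle {R : realType} {T T' : Type}
    (d : T -> T -> R) (d' : T' -> T' -> R)
    (D : geodesic_triangle d) (D' : geodesic_triangle d') : Prop :=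
  forall i j, d (vertex D i) (vertex D j) = d' (vertex D' i) (vertex D' j).

Definition corresponding_point {R : realType} {T T' : Type}
    (d : T -> T -> R) (d' : T' -> T' -> R)
    (D : geodesic_triangle d) (D' : geodesic_triangle d') (i : 'I_3)
    (x : T) (x' : T') : Prop :=
  [/\ edge D i x, edge D' i x' & d' x' (vertex D' i) = d x (vertex D i)].

Definition curvature_bounded_below {R : realType} (E : metricType R)
    (kappa : R) : Prop :=
  forall (D : geodesic_triangle (@mdist R E))
         (D' : geodesic_triangle (model_dist kappa)),
    comparison_triangle D D' ->
    forall (i j : 'I_3) (x y : E) (x' y' : hyperbolic_plane R),
      corresponding_point D D' i x x' -> corresponding_point D D' j y y' ->
      model_dist kappa x' y' <= mdist x y.

Definition bounded_subset {R : realType} {E : metricType R} (X : set E) : Prop :=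
  exists M : R, forall x y, X x -> X y -> mdist x y <= M.

Definition Pbcl {R : realType} (E : metricType R) : set (set E) :=
  [set X | [/\ X !=set0, bounded_subset X & closed X]].

Record Pbclcv {R : realType} (E : metricType R) := MkPbclcv {
  Pbclcv_set :> set E;
  Pbclcv_bcl : Pbcl Pbclcv_set;
  Pbclcv_convex : geodesically_convex Pbclcv_set }.

Definition set_dist {R : realType} {E : metricType R} (z : E) (X : set E) : R :=
  inf [set mdist z x | x in X].

Definition excess {R : realType} {E : metricType R} (X Y : set E) : R :=
  sup [set set_dist x Y | x in X].

Definition pompeiu_hausdorff {R : realType} {E : metricType R} (X Y : set E) :
  R := Num.max (excess X Y) (excess Y X).

Section PompeiuHausdorffMetric.
Context {R : realType} {E : metricType R}.
Implicit Types X Y Z : set E.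

Lemma has_inf_dist (z : E) Y : Y !=set0 -> has_inf [set mdist z y | y in Y].
Proof.
move=> [y Yy]; split; first by exists (mdist z y), y.
by exists 0 => _ [u _ <-]; exact: mdist_ge0.
Qed.

Lemma set_dist_le (z y : E) Y : Y y -> set_dist z Y <= mdist z y.
Proof.
move=> Yy; apply: ge_inf; last by exists y.
by exists 0 => _ [u _ <-]; exact: mdist_ge0.
Qed.

Lemma set_dist_ge0 (z : E) Y : Y !=set0 -> 0 <= set_dist z Y.
Proof.
move=> [y Yy]; apply: lb_le_inf; first by exists (mdist z y), y.
by move=> _ [u _ <-]; exact: mdist_ge0.
Qed.

Lemma set_dist_approx (z : E) Y (e : R) : Y !=set0 -> 0 < e ->
  exists2 y, Y y & mdist z y < set_dist z Y + e.
Proof.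
move=> Y0 e0.
have [_ [y Yy <-] ylt] := inf_adherent e0 (has_inf_dist z Y0).
by exists y.
Qed.

Lemma has_sup_excess X Y : Pbcl X -> Pbcl Y ->
  has_sup [set set_dist x Y | x in X].
Proof.
move=> [[x Xx] [M XM] _] [[y Yy] _ _]; split; first by exists (set_dist x Y), x.
exists (M + mdist x y) => _ [u Xu <-].
apply: (le_trans (set_dist_le u Yy)).
by apply: (le_trans (metric_triangle u x y)); rewrite lerD2r XM.
Qed.

Lemma set_dist_excess X Y (x : E) : Pbcl X -> Pbcl Y -> X x ->
  set_dist x Y <= excess X Y.
Proof.
move=> bX bY Xx; apply: ub_le_sup; last by exists x.
by case: (has_sup_excess bX bY).
Qed.

Lemma excess_le X Y (M : R) : Pbcl X ->
  (forall x, X x -> set_dist x Y <= M) -> excess X Y <= M.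
Proof.
move=> [[x Xx] _ _] H; apply: ge_sup; first by exists (set_dist x Y), x.
by move=> _ [u Xu <-]; exact: H.
Qed.

Lemma excess_ge0 X Y : Pbcl X -> Pbcl Y -> 0 <= excess X Y.
Proof.
move=> bX bY; have [[x Xx] _ _] := bX; have [Y0 _ _] := bY.
exact: le_trans (set_dist_ge0 x Y0) (set_dist_excess bX bY Xx).
Qed.

Lemma excess_refl X : Pbcl X -> excess X X = 0.
Proof.
move=> bX; apply/eqP; rewrite eq_le excess_ge0// andbT.
by apply: excess_le => // x Xx; rewrite -(mdistxx x) set_dist_le.
Qed.

Lemma excess_sub X Y : Pbcl X -> Pbcl Y -> excess X Y <= 0 -> X `<=` Y.
Proof.
move=> bX bY XY0 x Xx; have [Y0 _ cY] := bY; apply: cY.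
move=> B /(@metricType_numDomainType.nbhs_mdistP R E) [e /= e0 eB].
have [y Yy xy] := set_dist_approx x Y0 e0.
exists y; split => //; apply: eB => /=.
have := set_dist_excess bX bY Xx; lra.
Qed.

Lemma excess_triangle Y X Z : Pbcl X -> Pbcl Y -> Pbcl Z ->
  excess X Z <= excess X Y + excess Y Z.
Proof.
move=> bX bY bZ; apply: excess_le => // x Xx.
have [Y0 _ _] := bY; have [Z0 _ _] := bZ.
apply/ler_addgt0Pr => e e0; have e20 : 0 < e / 2 by lra.
have [y Yy xy] := set_dist_approx x Y0 e20.
have [z Zz yz] := set_dist_approx y Z0 e20.
have := set_dist_le x Zz; have := metric_triangle x y z.
have := set_dist_excess bX bY Xx; have := set_dist_excess bY bZ Yy.
lra.
Qed.

Let H := Pbclcv E.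
Let h (X Y : H) : R := pompeiu_hausdorff X Y.

Let hxx (X : H) : h X X = 0.
Proof.
by rewrite /h /pompeiu_hausdorff (excess_refl (Pbclcv_bcl X)) maxxx.
Qed.

Let h_positivity (X Y : H) : h X Y = 0 -> X = Y.
Proof.
move=> XY; have bX := Pbclcv_bcl X; have bY := Pbclcv_bcl Y.
have eqXY : X = Y :> set E.
  by apply/seteqP; split; apply: excess_sub => //;
    rewrite -XY /h /pompeiu_hausdorff le_max lexx ?orbT.
case: X Y eqXY {XY bX bY} => [X pX cX] [Y pY cY] /= XY; subst Y.
by congr MkPbclcv; exact: Prop_irrelevance.
Qed.

Let h_sym (X Y : H) : h X Y = h Y X.
Proof. exact: maxC. Qed.

Let h_triangle (Y X Z : H) : h X Z <= h X Y + h Y Z.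
Proof.
have bX := Pbclcv_bcl X; have bY := Pbclcv_bcl Y; have bZ := Pbclcv_bcl Z.
rewrite /h /pompeiu_hausdorff ge_max; apply/andP; split.
  by apply: le_trans (excess_triangle bX bY bZ) _;
    apply: lerD; rewrite le_max lexx.
by apply: le_trans (excess_triangle bZ bY bX) _; rewrite addrC;
  apply: lerD; rewrite le_max lexx orbT.
Qed.

HB.instance Definition _ := gen_eqMixin (Pbclcv E).
HB.instance Definition _ := gen_choiceMixin (Pbclcv E).
HB.instance Definition _ :=
  isMetric.Build R (Pbclcv E) hxx h_positivity h_sym h_triangle.

End PompeiuHausdorffMetric.

Lemma Pbclcv_mdistE {R : realType} {E : metricType R} (X Y : Pbclcv E) :
  mdist X Y = pompeiu_hausdorff X Y.
Proof. by []. Qed.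

Definition lambda {R : realType} {E : metricType R} (X Y : set E) : R :=
  inf [set d | exists x y, [/\ X x, Y y & d = mdist x y]].

Definition PbclcvA {R : realType} {E : metricType R} (A : set E) :
    set (Pbclcv E) :=
  closure [set X : Pbclcv E | 0 < lambda X A].

Definition min_solution {R : realType} {E : metricType R} (X Y : set E)
    (z : E * E) : Prop :=
  [/\ X z.1, Y z.2 & mdist z.1 z.2 = lambda X Y].

Definition minimizing_sequence {R : realType} {E : metricType R}
    (X Y : set E) (x y : nat -> E) : Prop :=
  [/\ forall n, X (x n), forall n, Y (y n) &
      mdist (x n) (y n) @[n --> \oo] --> lambda X Y].

Definition min_well_posed {R : realType} {E : metricType R}
    (X Y : set E) : Prop :=
  exists z0 : E * E,
    [/\ min_solution X Y z0,
        forall z, min_solution X Y z -> z = z0 &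
        forall x y : nat -> E, minimizing_sequence X Y x y ->
          (x n @[n --> \oo] --> z0.1) /\ (y n @[n --> \oo] --> z0.2)].

(* A set of points of the subtype of Pbclcv E given by PbclcvA A, which the
   library endows with the topology induced by the Pompeiu-Hausdorff metric. *)
Definition Wmin {R : realType} {E : metricType R} (A : set E) :
    set (PbclcvA A) :=
  [set X : PbclcvA A | min_well_posed A (set_val X : Pbclcv E)].
Arguments Wmin {R E} A _.

(* Main.v *)
Require Import Defs.
From mathcomp Require Import all_boot all_order all_algebra.
From mathcomp Require Import all_classical all_reals all_analysis borel_hierarchy.
From mathcomp Require Import ring lra.

Set Implicit Arguments.
Unset Strict Implicit.
Unset Printing Implicit Defensive.
Import Order.TTheory GRing.Theory Num.Theory.
Import numFieldNormedType.Exports.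
Local Open Scope classical_set_scope.
Local Open Scope ring_scope.

(** Well-posedness of min(A, X) means that the pairs almost realizing the distance between
    A and X accumulate at one point; for each scale this is an open condition on X, which
    gives the G_delta part.

    For density, let d(x, a) be almost equal to lambda, the distance from A to X. Move x
    towards a by a small r, to y, and replace X by the convex set
    Y = {z | dist (z, X) + k d(z, y) <= r}, with k so small that Y contains X. A pair (a', y')
    almost realizing the distance between A and Y has dist (y', X) almost r, hence y' is
    close to y. Then a' is almost at distance d(y, a) from y and at least lambda from x, so
    that a' almost prolongs the segment [x, y], as a does; by the lower curvature bound
    (Stewart's theorem in the hyperbolic comparison triangle) geodesics do not branch, and a'
    is close to a. Iterating with small radii yields an increasing sequence of convex sets,
    and the closure of its union is a well-posed approximation of X. *)

(** * Hyperbolic functions and estimates for cosh *)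

Section HyperbolicFunctions.
Context {R : realType}.
Implicit Types t u : R.

Definition cosh t : R := (expR t + expR (- t)) / 2.
Definition sinh t : R := (expR t - expR (- t)) / 2.

Lemma coshN t : cosh (- t) = cosh t.
Proof. by rewrite /cosh opprK addrC. Qed.

Lemma cosh_norm t : cosh `|t| = cosh t.
Proof. by case: (ger0P t) => // _; rewrite coshN. Qed.

Lemma sinhN t : sinh (- t) = - sinh t.
Proof. by rewrite /sinh opprK -mulNr opprB. Qed.

Lemma cosh0 : cosh 0 = 1.
Proof. by rewrite /cosh oppr0 expR0; lra. Qed.

Lemma sinh0 : sinh 0 = 0.
Proof. by rewrite /sinh oppr0 expR0; lra. Qed.

Lemma coshD t u : cosh (t + u) = cosh t * cosh u + sinh t * sinh u.
Proof. by rewrite /cosh /sinh opprD !expRD; field. Qed.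

Lemma sinhD t u : sinh (t + u) = sinh t * cosh u + cosh t * sinh u.
Proof. by rewrite /cosh /sinh opprD !expRD; field. Qed.

Lemma coshB t u : cosh (t - u) = cosh t * cosh u - sinh t * sinh u.
Proof. by rewrite coshD coshN sinhN mulrN. Qed.

Lemma sinhB t u : sinh (t - u) = sinh t * cosh u - cosh t * sinh u.
Proof. by rewrite sinhD coshN sinhN mulrN. Qed.

Lemma cosh2_sinh2 t : cosh t ^+ 2 - sinh t ^+ 2 = 1.
Proof. by rewrite -(cosh0) -(subrr t) coshB; ring. Qed.

Lemma cosh_gt0 t : 0 < cosh t.
Proof. by rewrite divr_gt0 ?addr_gt0 ?expR_gt0. Qed.

Lemma sinh_gt0 t : 0 < t -> 0 < sinh t.
Proof.
by move=> t0; rewrite divr_gt0 ?subr_gt0 ?ltr_expR//; lra.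
Qed.

Lemma sinh_ge0 t : 0 <= t -> 0 <= sinh t.
Proof. by rewrite le_eqVlt => /predU1P[<-|/sinh_gt0/ltW//]; rewrite sinh0. Qed.

Lemma le_cosh t u : - u <= t -> t <= u -> cosh t <= cosh u.
Proof.
move=> ut tu; rewrite -subr_ge0.
have -> : cosh u - cosh t = (expR u - expR t) * (1 - expR (- u - t)) / 2.
  have : expR t != 0 := lt0r_neq0 (expR_gt0 t).
  have : expR u != 0 := lt0r_neq0 (expR_gt0 u).
  by rewrite /cosh expRD !expRN => ? ?; field; apply/andP.
rewrite divr_ge0// mulr_ge0// subr_ge0 ?ler_expR//.
by rewrite -expR0 ler_expR; lra.
Qed.

Lemma cosh_ge1 t : 1 <= cosh t.
Proof. by rewrite -cosh_norm -cosh0 le_cosh// oppr_le0. Qed.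

(** Half-angle formula: [cosh v - 1] is twice the square of [sinh (v / 2)], and the two exponentials
    in it differ by at least [v / 2]. Used to turn a small [cosh - 1] into a small distance. *)
Lemma cosh_ge_quadratic t : t ^+ 2 / 8 <= cosh t - 1.
Proof.
rewrite -cosh_norm -real_normK ?num_real//; set v := `|t|.
have v0 : 0 <= v by exact: normr_ge0.
have e1 : expR (v / 2) * expR (- (v / 2)) = 1 by rewrite expRxMexpNx_1.
have -> : cosh v - 1 = (expR (v / 2) - expR (- (v / 2))) ^+ 2 / 2.
  have -> : cosh v = (expR (v / 2) ^+ 2 + expR (- (v / 2)) ^+ 2) / 2.
    by rewrite /cosh {1 2}(splitr v) opprD !expRD.
  by rewrite sqrrB e1; lra.
have e2 : expR (- (v / 2)) <= 1 by rewrite -[leRHS]expR0 ler_expR; lra.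
have e3 := expR_ge1Dx (v / 2).
have : (v / 2) ^+ 2 <= (expR (v / 2) - expR (- (v / 2))) ^+ 2.
  by rewrite ler_sqr ?nnegrE; lra.
nra.
Qed.

(** Multiply [1 - u <= expR (- u)] by [expR (t + u)]; the decreasing exponentials only help. *)
Lemma coshB_le t u : 0 <= u -> 0 <= t ->
  cosh (t + u) - cosh t <= u * expR (t + u).
Proof.
move=> u0 t0.
have h : expR (t + u) - expR t <= u * expR (t + u).
  have := expR_ge1Dx (- u).
  rewrite -(ler_pM2l (expR_gt0 (t + u))) -expRD addrK; lra.
have h1 : expR (- (t + u)) <= expR (- t) by rewrite ler_expR; lra.
have h2 : 0 <= u * expR (t + u) by rewrite mulr_ge0 ?expR_ge0.
rewrite /cosh; lra.
Qed.

Lemma arcosh_cosh t : 0 <= t -> arcosh (cosh t) = t.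
Proof.
move=> t0; rewrite /arcosh.
have -> : Num.sqrt (cosh t ^+ 2 - 1) = sinh t.
  rewrite -(ger0_norm (sinh_ge0 t0)) -sqrtr_sqr; congr Num.sqrt.
  by have := cosh2_sinh2 t; lra.
by rewrite -[RHS]expRK; congr ln; rewrite /cosh /sinh; lra.
Qed.

(** For [z < 1], where [arcosh] has no geometric meaning, [1 <= cosh t] suffices; so [le_model_dist]
    can apply this to any two points of the plane. *)
Lemma arcosh_le_cosh (z : R) t : arcosh z <= t -> z <= cosh t.
Proof.
move=> zt; have [z1|z1] := ltP z 1.
  exact: le_trans (ltW z1) (cosh_ge1 t).
set q := Num.sqrt (z ^+ 2 - 1).
have q0 : 0 <= q by exact: sqrtr_ge0.
have q2 : q ^+ 2 = z ^+ 2 - 1 by rewrite sqr_sqrtr//; nra.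
have w1 : 1 <= z + q by lra.
have zw : z + q = expR (arcosh z) by rewrite /arcosh -/q lnK// posrE; lra.
have zE : z = cosh (arcosh z).
  rewrite /cosh expRN -zw; field: q2; lra.
rewrite zE le_cosh//.
have : 0 <= arcosh z by rewrite ln_ge0.
lra.
Qed.

End HyperbolicFunctions.

(** * Segments and comparison triangles in the hyperboloid model *)

Section HyperbolicPlane.
Context {R : realType}.
Implicit Types u v w : hyperbolic_plane R.

Lemma hyperbolic_plane_ext u v :
  hyp_x u = hyp_x v -> hyp_y u = hyp_y v -> hyp_z u = hyp_z v -> u = v.
Proof.
case: u v => [x y z f p] [x' y' z' f' p'] /= ? ? ?; subst.
by congr HyperbolicPlane; exact: Prop_irrelevance.
Qed.

Lemma lorentzC u v : lorentz u v = lorentz v u.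
Proof. by rewrite /lorentz; ring. Qed.

Lemma lorentzxx u : lorentz u u = -1.
Proof. by rewrite -(hyp_form u) /lorentz; ring. Qed.

(** The equation on [a] and [b] is <w, w> = -1 expanded for w = a u + b v; the sign conditions keep
    w on the upper sheet. *)
Lemma hyperbolic_combination (a b : R) u v : 0 <= a -> 0 <= b -> 0 < a + b ->
  a ^+ 2 + b ^+ 2 - a * b * lorentz u v *+ 2 = 1 ->
  exists w, [/\ hyp_x w = a * hyp_x u + b * hyp_x v,
    hyp_y w = a * hyp_y u + b * hyp_y v & hyp_z w = a * hyp_z u + b * hyp_z v].
Proof.
move=> a0 b0 ab0 ab.
suff [fw pw] : (a * hyp_x u + b * hyp_x v) ^+ 2 +
    (a * hyp_y u + b * hyp_y v) ^+ 2 - (a * hyp_z u + b * hyp_z v) ^+ 2 = -1 /\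
    0 < a * hyp_z u + b * hyp_z v.
  by exists (HyperbolicPlane fw pw).
split.
  move: (hyp_form u) (hyp_form v) ab; rewrite /lorentz => fu fv ab.
  nra.
have [zu zv] := (hyp_z_gt0 u, hyp_z_gt0 v).
have [a1|a1] := ltP 0 a; first by rewrite ltr_wpDr ?mulr_gt0// mulr_ge0// ltW.
by rewrite ltr_wpDl ?mulr_gt0 ?mulr_ge0//; lra.
Qed.

Lemma lorentz_combination (a b a' b' : R) u v w w' :
  [/\ hyp_x w = a * hyp_x u + b * hyp_x v,
    hyp_y w = a * hyp_y u + b * hyp_y v & hyp_z w = a * hyp_z u + b * hyp_z v] ->
  [/\ hyp_x w' = a' * hyp_x u + b' * hyp_x v,
    hyp_y w' = a' * hyp_y u + b' * hyp_y v &
    hyp_z w' = a' * hyp_z u + b' * hyp_z v] ->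
  lorentz w w' = - (a * a') - b * b' + (a * b' + a' * b) * lorentz u v.
Proof.
move=> [wx wy wz] [wx' wy' wz'].
have -> : lorentz w w' = a * a' * lorentz u u + b * b' * lorentz v v +
    (a * b' + a' * b) * lorentz u v.
  by rewrite /lorentz wx wy wz wx' wy' wz'; ring.
by rewrite !lorentzxx; ring.
Qed.

(** Divided by [sinh l ^+ 2], this is - <w, w'> = cosh (t - t') for the points w, w' of parameters
    t, t' on a segment of length l. *)
Lemma sinh_identity (l t t' : R) :
  sinh (l - t) * sinh (l - t') + sinh t * sinh t' +
    (sinh (l - t) * sinh t' + sinh (l - t') * sinh t) * cosh l =
  sinh l ^+ 2 * cosh (t - t').
Proof.
rewrite !sinhB coshB.
have h : cosh l ^+ 2 = sinh l ^+ 2 + 1 by have := cosh2_sinh2 l; lra.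
transitivity (sinh l ^+ 2 * cosh t * cosh t' + sinh t * sinh t' -
   sinh t * sinh t' * cosh l ^+ 2); first by ring.
by rewrite h; ring.
Qed.

Context (kappa : R).
Hypothesis kappa_lt0 : kappa < 0.
Let s : R := Num.sqrt (- kappa).

Let s_gt0 : 0 < s.
Proof. by rewrite sqrtr_gt0 oppr_gt0. Qed.

Lemma model_dist_cosh u v (l : R) : 0 <= l ->
  - lorentz u v = cosh (s * l) -> model_dist kappa u v = l.
Proof.
move=> l0 uv; rewrite /model_dist /hyp_dist uv arcosh_cosh ?mulr_ge0 ?(ltW s_gt0)//.
by rewrite mulKf// lt0r_neq0.
Qed.

Lemma model_distxx u : model_dist kappa u u = 0.
Proof. by apply: model_dist_cosh; rewrite // lorentzxx mulr0 cosh0 opprK. Qed.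

Lemma model_distC u v : model_dist kappa u v = model_dist kappa v u.
Proof. by rewrite /model_dist /hyp_dist lorentzC. Qed.

Lemma le_model_dist u v (l : R) :
  model_dist kappa u v <= l -> - lorentz u v <= cosh (s * l).
Proof.
move=> uvl; apply: arcosh_le_cosh.
by rewrite -(ler_pM2l (_ : 0 < s^-1)) ?invr_gt0// mulKf// lt0r_neq0.
Qed.

(** Hyperbolic counterpart of spherical linear interpolation. The coordinates are part of the
    statement because Stewart's theorem is read off from them by linearity of [lorentz]. *)
Lemma model_segment u v (l : R) : 0 < l -> - lorentz u v = cosh (s * l) ->
  exists S, geodesic_segment (model_dist kappa) u v S /\
    forall t, 0 <= t <= l -> exists2 w, S w &
      [/\ hyp_x w = sinh (s * (l - t)) / sinh (s * l) * hyp_x u +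
            sinh (s * t) / sinh (s * l) * hyp_x v,
        hyp_y w = sinh (s * (l - t)) / sinh (s * l) * hyp_y u +
            sinh (s * t) / sinh (s * l) * hyp_y v &
        hyp_z w = sinh (s * (l - t)) / sinh (s * l) * hyp_z u +
            sinh (s * t) / sinh (s * l) * hyp_z v].
Proof.
move=> l0 uvl.
have sl0 : 0 < sinh (s * l) by rewrite sinh_gt0// mulr_gt0.
have sl1 : sinh (s * l) != 0 by exact: lt0r_neq0.
pose a t := sinh (s * (l - t)) / sinh (s * l).
pose b t := sinh (s * t) / sinh (s * l).
have aabb t t' :
    a t * a t' + b t * b t' + (a t * b t' + a t' * b t) * cosh (s * l) =
    cosh (s * (t - t')).
  apply: (mulfI (expf_neq0 2 sl1)).
  by rewrite mulrBr -sinh_identity -!mulrBr /a /b; field.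
have [c cP] : {c : R -> hyperbolic_plane R & forall t, 0 <= t <= l ->
    [/\ hyp_x (c t) = a t * hyp_x u + b t * hyp_x v,
      hyp_y (c t) = a t * hyp_y u + b t * hyp_y v &
      hyp_z (c t) = a t * hyp_z u + b t * hyp_z v]}.
  apply: (@choice _ _ (fun t w => 0 <= t <= l -> [/\ hyp_x w = _, hyp_y w = _ & hyp_z w = _])) => t.
  have [t0l|] := boolP (0 <= t <= l); last by exists u.
  have [t0 tl] := andP t0l.
  have a0 : 0 <= a t.
    by rewrite divr_ge0 ?(ltW sl0)// sinh_ge0// mulr_ge0 ?subr_ge0// ltW.
  have b0 : 0 <= b t by rewrite divr_ge0 ?(ltW sl0)// sinh_ge0// mulr_ge0// ltW.
  have ab1 := aabb t t; rewrite subrr mulr0 cosh0 -uvl in ab1.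
  have [||w wP] := @hyperbolic_combination (a t) (b t) u v a0 b0.
  - rewrite lt0r addr_ge0// andbT paddr_eq0//; apply/negP => /andP[/eqP a00 /eqP b00].
    by move: ab1; rewrite a00 b00; lra.
  - by rewrite -ab1; ring.
  by exists w.
have c0 : c 0 = u.
  have [|x y z] := cP 0; first by rewrite lexx ltW.
  by apply: hyperbolic_plane_ext; rewrite ?x ?y ?z /a /b subr0 mulr0 sinh0 divff//; ring.
have cl : c l = v.
  have [|x y z] := cP l; first by rewrite lexx ltW.
  by apply: hyperbolic_plane_ext; rewrite ?x ?y ?z /a /b subrr mulr0 sinh0 divff//; ring.
exists (c @` `[0, l]); split.
  exists l, c; split => //; split => //; first exact: ltW.
  move=> t t'; rewrite !in_itv /= => tl tl'.
  apply: model_dist_cosh => //; rewrite (lorentz_combination (cP t tl) (cP t' tl')).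
  rewrite -{1}(gtr0_norm s_gt0) -normrM cosh_norm -aabb -uvl; ring.
move=> t tl; exists (c t); last exact: cP.
by exists t => //=; rewrite in_itv.
Qed.

(** Put u at the apex (0, 0, 1) and v at distance a in the plane y = 0. The law of cosines forces
    the first coordinate p of w, which plays the role of sinh (s b) times the cosine of the angle at
    u; the triangle inequalities give |p| <= sinh (s b), so that the second coordinate q exists. *)
Lemma comparison_vertices (a b c : R) : 0 < a -> 0 <= b -> 0 <= c ->
  c <= a + b -> a <= b + c -> b <= a + c ->
  exists u v w, [/\ - lorentz u v = cosh (s * a), - lorentz u w = cosh (s * b) &
    - lorentz v w = cosh (s * c)].
Proof.
move=> a0 b0 c0 cab abc bac.
have sa0 : 0 < sinh (s * a) by rewrite sinh_gt0// mulr_gt0.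
have sb0 : 0 <= sinh (s * b) by rewrite sinh_ge0// mulr_ge0// ltW.
have s0 := ltW s_gt0.
pose p := (cosh (s * a) * cosh (s * b) - cosh (s * c)) / sinh (s * a).
have pE : p * sinh (s * a) = cosh (s * a) * cosh (s * b) - cosh (s * c).
  by rewrite divfK// lt0r_neq0.
have p2 : p ^+ 2 <= sinh (s * b) ^+ 2.
  have h1 : cosh (s * c) <= cosh (s * a + s * b).
    rewrite -mulrDr le_cosh// ?ler_wpM2l// -mulrN ler_wpM2l//; lra.
  have h2 : cosh (s * a - s * b) <= cosh (s * c).
    rewrite -mulrBr le_cosh// -?mulrN ler_wpM2l//; lra.
  move: h1 h2; rewrite coshD coshB => h1 h2.
  rewrite -(real_normK (num_real p)) ler_sqr ?nnegrE//.
  rewrite -(ler_pM2r sa0) -{1}(gtr0_norm sa0) -normrM pE.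
  by rewrite ler_norml; apply/andP; split; lra.
pose q := Num.sqrt (sinh (s * b) ^+ 2 - p ^+ 2).
have q2 : q ^+ 2 = sinh (s * b) ^+ 2 - p ^+ 2 by rewrite sqr_sqrtr// subr_ge0.
have fu : 0 ^+ 2 + 0 ^+ 2 - 1 ^+ 2 = -1 :> R by ring.
have fv : sinh (s * a) ^+ 2 + 0 ^+ 2 - cosh (s * a) ^+ 2 = -1.
  by have := cosh2_sinh2 (s * a); lra.
have fw : p ^+ 2 + q ^+ 2 - cosh (s * b) ^+ 2 = -1.
  by have := cosh2_sinh2 (s * b); rewrite q2; lra.
exists (HyperbolicPlane fu ltr01), (HyperbolicPlane fv (cosh_gt0 _)),
  (HyperbolicPlane fw (cosh_gt0 _)).
by rewrite /lorentz /=; split; lra.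
Qed.

End HyperbolicPlane.

(** * The lower curvature bound and non-branching of geodesics *)

Section CurvatureBoundedBelow.
Context {R : realType} {E : metricType R} (kappa : R).
Hypothesis hgeodesic : geodesic_space E.
Hypothesis kappa_lt0 : kappa < 0.
Hypothesis hcurv : curvature_bounded_below E kappa.
Let s : R := Num.sqrt (- kappa).

Let s_gt0 : 0 < s.
Proof. by rewrite sqrtr_gt0 oppr_gt0. Qed.

Lemma geodesic_length (x y : E) (l : R) (c : R -> E) :
  geodesic_path mdist x y l c -> l = mdist x y.
Proof.
move=> [l0 <- <- ->]; rewrite ?in_itv/= ?lexx ?l0//.
by rewrite sub0r normrN ger0_norm.
Qed.

(* Stewart's theorem, an equality in the hyperbolic plane. *)
Lemma stewart_le (x a a' : E) (c : R -> E) (r : R) :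
  geodesic_path mdist x a (mdist x a) c -> 0 <= r <= mdist x a ->
  x <> a -> x <> a' -> a <> a' ->
  sinh (s * (mdist x a - r)) * cosh (s * mdist x a') +
    sinh (s * r) * cosh (s * mdist a a') <=
  sinh (s * mdist x a) * cosh (s * mdist (c r) a').
Proof.
move=> gc rL /eqP xa /eqP xa' /eqP aa'.
have L0 : 0 < mdist x a by rewrite mdist_gt0.
have [u [v [w [uv uw vw]]]] := comparison_vertices kappa_lt0 L0 (mdist_ge0 x a')
  (mdist_ge0 a a') ltac:(by rewrite (metric_sym x a) metric_triangle)
  ltac:(by rewrite addrC (metric_sym a a') addrC metric_triangle)
  (metric_triangle x a a').
have [S0 [gS0 S0P]] := model_segment kappa_lt0 L0 uv.
have [S1 [gS1 _]] : exists S, geodesic_segment (model_dist kappa) v w S /\ True.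
  have [|S [? _]] := model_segment kappa_lt0 _ vw; first by rewrite mdist_gt0.
  by exists S.
have [S2 [gS2 _]] : exists S, geodesic_segment (model_dist kappa) w u S /\ True.
  rewrite lorentzC in uw.
  have [|S [? _]] := model_segment kappa_lt0 _ uw; first by rewrite mdist_gt0.
  by exists S.
have seg (y z : E) : exists S, geodesic_segment mdist y z S.
  by have [l [g gP]] := hgeodesic y z; exists (g @` `[0, l]), l, g.
have [T1 gT1] := seg a a'; have [T2 gT2] := seg a' x.
have gT0 : geodesic_segment mdist x a (c @` `[0, mdist x a]).
  by exists (mdist x a), c.
pose three (T : Type) (p q o : T) (i : 'I_3) :=
  match val i with 0%N => p | 1%N => q | _ => o end.
have [D [DV DE]] : exists D : geodesic_triangle (@mdist R E),
    vertex D = three _ x a a' /\ edge D = three _ (c @` `[0, mdist x a]) T1 T2.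
  unshelve eexists; first exists (three _ x a a') (three _ (c @` `[0, mdist x a]) T1 T2).
    by case=> [[|[|[|//]]] ?].
  by [].
have [D' [DV' DE']] : exists D' : geodesic_triangle (model_dist kappa),
    vertex D' = three _ u v w /\ edge D' = three _ S0 S1 S2.
  unshelve eexists; first exists (three _ u v w) (three _ S0 S1 S2).
    by case=> [[|[|[|//]]] ?].
  by [].
have duv := model_dist_cosh kappa_lt0 (mdist_ge0 x a) uv.
have duw := model_dist_cosh kappa_lt0 (mdist_ge0 x a') uw.
have dvw := model_dist_cosh kappa_lt0 (mdist_ge0 a a') vw.
have DD' : comparison_triangle D D'.
  move=> i j; rewrite DV DV'.
  case: i => [[|[|[|//]]] ?]; case: j => [[|[|[|//]]] ?]; rewrite /three /=;
    by rewrite ?mdistxx ?(model_distxx kappa_lt0) // 1?metric_sym 1?model_distC.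
have [z S0z [zx zy zz]] := S0P r rL.
have [r0 rL'] := andP rL.
have sL : sinh (s * mdist x a) != 0 by rewrite lt0r_neq0// sinh_gt0// mulr_gt0.
have zu : model_dist kappa z u = r.
  apply: (model_dist_cosh kappa_lt0) => //.
  rewrite (@lorentz_combination _ _ _ 1 0 u v _ _ (And3 zx zy zz)); last first.
    by split; ring.
  transitivity ((sinh (s * (mdist x a - r)) + sinh (s * r) * cosh (s * mdist x a))
      / sinh (s * mdist x a)); first by rewrite -uv; field.
  by rewrite mulrBr sinhB; field.
(* Equality in Stewart's theorem: [lorentz] is linear in z, a combination of u and v. *)
have zw : - lorentz z w = (sinh (s * (mdist x a - r)) * cosh (s * mdist x a') +
    sinh (s * r) * cosh (s * mdist a a')) / sinh (s * mdist x a).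
  by rewrite -uw -vw /lorentz zx zy zz; field.
have [_ cx _ cd] := gc.
have crx : mdist (c r) x = r.
  by rewrite -[in LHS]cx cd ?in_itv//= ?lexx ?mdist_ge0// subr0 ger0_norm.
have : model_dist kappa z w <= mdist (c r) a'.
  (* The points compared are [c r] on edge 0, from x to a, and a' as the initial point of edge 2,
     from a' to x. *)
  apply: (@hcurv D D' DD' ord0 (@Ordinal 3 2 isT)).
    split; rewrite ?DV ?DV' ?DE ?DE' /three //= ?zu//.
    by exists r => //=; rewrite in_itv.
  split; rewrite ?DV ?DV' ?DE ?DE' /three //=.
  - by have [l [g [[l0 g0 _ _] ->]]] := gT2; exists 0 => //=; rewrite in_itv /= lexx.
  - by have [l [g [[l0 g0 _ _] ->]]] := gS2; exists 0 => //=; rewrite in_itv /= lexx.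
  - by rewrite mdistxx (model_distxx kappa_lt0).
move=> /(le_model_dist kappa_lt0); rewrite zw.
by rewrite ler_pdivrMr ?sinh_gt0 ?mulr_gt0 // [leRHS]mulrC.
Qed.

(** With e = 0 and L = d(x, a), Stewart's inequality and the addition formula for sinh (s L - s (L -
    r)) would give sinh (s r) (cosh (s d(a, a')) - 1) <= 0, hence a = a'. For e > 0 the right-hand
    side becomes an error linear in e, uniform for L <= M. *)
Lemma geodesic_nonbranching (r M w : R) : 0 < r -> 0 < w -> exists2 e : R, 0 < e &
  forall (x a a' : E) (c : R -> E),
    geodesic_path mdist x a (mdist x a) c -> r <= mdist x a <= M ->
    mdist x a - e <= mdist x a' -> mdist (c r) a' <= mdist x a - r + e ->
    mdist a a' <= w.
Proof.
move=> r0 w0.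
have sr0 : 0 < sinh (s * r) by rewrite sinh_gt0// mulr_gt0.
(* [K * e] bounds the total error: each of the two cosh terms is off by at most
   [s * e * expR (s * M + s)] and has a coefficient sinh at most [expR (s * M)]. Then [e0] makes
   [K * e0] equal to sinh (s r) (s w)^2 / 8, to match [cosh_ge_quadratic]. *)
pose K := expR (s * M) * (s * expR (s * M + s)) *+ 2.
have K0 : 0 < K by rewrite pmulrn_lgt0// !mulr_gt0 ?expR_gt0.
pose e0 := sinh (s * r) * (s * w) ^+ 2 / 8 / K.
have e00 : 0 < e0 by rewrite !divr_gt0// mulr_gt0// exprn_gt0// mulr_gt0.
(* The bound 1 keeps the exponents below [s * M + s]; the bound [r / 2] keeps [L - e] positive and
   a' distinct from x. *)
pose e := Num.min (Num.min 1 (r / 2)) e0.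
have e_gt0 : 0 < e by rewrite !lt_min ltr01 e00 divr_gt0.
have : e <= Num.min 1 (r / 2) by rewrite ge_min lexx.
rewrite le_min => /andP[e1 er].
have ee0 : e <= e0 by rewrite ge_min lexx orbT.
exists e => // x a a' c gc /andP[rL LM] xa' ca'.
have [->|/eqP aa'] := eqVneq a a'; first by rewrite mdistxx ltW.
have xa : x <> a by move=> xa; move: rL; rewrite -xa mdistxx; lra.
have xa'0 : x <> a' by move=> xa'0; move: xa'; rewrite -xa'0 mdistxx; lra.
have st : sinh (s * (mdist x a - r)) * cosh (s * mdist x a') +
    sinh (s * r) * cosh (s * mdist a a') <=
    sinh (s * mdist x a) * cosh (s * mdist (c r) a').
  by apply: stewart_le => //; rewrite rL ltW.
move: rL LM xa' ca' st; set L := mdist x a; set b := mdist x a'.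
set m := mdist (c r) a'; set q := mdist a a' => rL LM Lb mL st.
have m0 : 0 <= m by exact: mdist_ge0.
pose X := s * e * expR (s * M + s).
have s0 := ltW s_gt0; have e0' := ltW e_gt0.
have se : s * e <= s by rewrite ler_piMr.
have sLM : s * L <= s * M by rewrite ler_wpM2l.
have cm : cosh (s * m) <= cosh (s * (L - r)) + X.
  rewrite -lerBlDl; apply: le_trans (_ : cosh (s * (L - r) + s * e) - cosh (s * (L - r)) <= _).
    rewrite lerD2r -mulrDr le_cosh// -?mulrN ler_wpM2l//; lra.
  apply: le_trans (coshB_le _ _) _; rewrite ?mulr_ge0// ?subr_ge0//.
  rewrite ler_wpM2l ?mulr_ge0// ler_expR lerD//.
  by apply: le_trans sLM; rewrite ler_wpM2l// gerBl ltW.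
have cb : cosh (s * L) - X <= cosh (s * b).
  rewrite lerBlDr -lerBlDl.
  apply: le_trans (_ : cosh (s * (L - e) + s * e) - cosh (s * (L - e)) <= _).
    rewrite -mulrDr subrK lerD2l lerN2 le_cosh// -?mulrN ler_wpM2l//; lra.
  apply: le_trans (coshB_le _ _) _; rewrite ?mulr_ge0// ?subr_ge0//; first by lra.
  by rewrite ler_wpM2l ?mulr_ge0// ler_expR -mulrDr subrK; lra.
have sinh_le t : t <= s * M -> sinh t <= expR (s * M).
  move=> tM; have : expR t <= expR (s * M) by rewrite ler_expR.
  have := expR_gt0 t; have := expR_gt0 (- t); rewrite /sinh; lra.
have Lr0 : 0 <= s * (L - r) by rewrite mulr_ge0// subr_ge0.
have LrM : s * (L - r) <= s * M by rewrite ler_wpM2l//; lra.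
have X0 : 0 <= X by rewrite !mulr_ge0// expR_ge0.
have sinh_r : sinh (s * r) = sinh (s * L) * cosh (s * (L - r)) -
    sinh (s * (L - r)) * cosh (s * L).
  rewrite (mulrC (sinh (s * (L - r)))) -sinhB; congr sinh; ring.
have key : sinh (s * r) * (cosh (s * q) - 1) <= K * e.
  have h1 := ler_wpM2l (sinh_ge0 (_ : 0 <= s * L)) cm.
  have {}h1 := h1 (mulr_ge0 s0 (mdist_ge0 x a)).
  have h2 := ler_wpM2l (sinh_ge0 Lr0) cb.
  have h3 := ler_wpM2r X0 (sinh_le _ sLM).
  have h4 := ler_wpM2r X0 (sinh_le _ LrM).
  have -> : K * e = expR (s * M) * X *+ 2 by rewrite /K /X; ring.
  nra.
have : (s * q) ^+ 2 <= (s * w) ^+ 2.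
  have h1 := cosh_ge_quadratic (s * q).
  suff h2 : cosh (s * q) - 1 <= (s * w) ^+ 2 / 8 by lra.
  rewrite -(ler_pM2l sr0); apply: le_trans key _.
  by rewrite [K * e]mulrC -ler_pdivlMr // [X in _ <= X / K]mulrA.
rewrite ler_sqr ?nnegrE ?mulr_ge0 ?mdist_ge0 ?(ltW w0)//.
by rewrite ler_pM2l.
Qed.

End CurvatureBoundedBelow.

(** * Convexity of the distance to a point and to a convex set *)

Section ConvexMetric.
Context {R : realType} {E : metricType R}.
Implicit Types (X Y : set E) (x y z : E) (c : R -> E).
Hypothesis hgeodesic : geodesic_space E.
Hypothesis hconvex : convex_metric E.

Lemma geodesic_path_rev x y (l : R) c : geodesic_path mdist x y l c ->
  geodesic_path mdist y x l (fun t => c (l - t)).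
Proof.
move=> [l0 cx cy cd]; split; rewrite ?subr0 ?subrr//.
move=> t t'; rewrite !in_itv /= => /andP[t0 tl] /andP[t0' tl'].
rewrite cd ?in_itv/=; [|by apply/andP; split; lra..].
by rewrite distrC; congr `|_|; ring.
Qed.

(** Cut the quadrilateral along a diagonal from z1 to x2: the convexity hypothesis applies to the
    geodesics issuing from z1, and to the reversed ones issuing from x2. *)
Lemma convex_metric_two_geodesics x1 x2 z1 z2 (l m t : R) c g :
  geodesic_path mdist z1 z2 l c -> geodesic_path mdist x1 x2 m g -> 0 <= t <= 1 ->
  mdist (c (t * l)) (g (t * m)) <= (1 - t) * mdist z1 x1 + t * mdist z2 x2.
Proof.
move=> gc gg t01; have [n [k gk]] := hgeodesic z1 x2.
have [_ _ cl _] := gc; have [_ g0 _ _] := gg; have [_ k0 kn _] := gk.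
have h1 := hconvex gc gk t01.
have := hconvex (geodesic_path_rev gk) (geodesic_path_rev gg) (t := 1 - t).
have -> : n - (1 - t) * n = t * n by ring.
have -> : m - (1 - t) * m = t * m by ring.
rewrite !subrr g0 k0 => h2; rewrite cl kn in h1.
have /h2 {}h2 : 0 <= 1 - t <= 1 by apply/andP; move/andP: t01 => []; split; lra.
have := metric_triangle (c (t * l)) (k (t * n)) (g (t * m)); lra.
Qed.

Lemma geodesic_segmentP x y S z : geodesic_segment mdist x y S -> S z ->
  exists l c t, [/\ geodesic_path mdist x y l c, 0 <= t <= 1 & z = c (t * l)].
Proof.
move=> [l [c [gc ->]]] [u /=]; rewrite in_itv /= => /andP[u0 ul] <-.
have [l0 _ _ _] := gc; exists l, c, (u / l); split => //.
(* If l = 0, then [u / l] is 0 by convention, and u is 0 as well. *)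
- have [l00|l1] := eqVneq l 0; first by rewrite l00 invr0 mulr0 lexx ler01.
  have lp : 0 < l by rewrite lt0r l1.
  by rewrite divr_ge0//= ler_pdivrMr// mul1r.
- have [l00|l1] := eqVneq l 0; last by rewrite divfK.
  by congr c; rewrite l00 mulr0; apply/le_anti; rewrite u0 -l00 ul.
Qed.

Lemma geodesic_path_segment x y (l t : R) c : geodesic_path mdist x y l c ->
  0 <= t <= 1 -> exists2 S, geodesic_segment mdist x y S & S (c (t * l)).
Proof.
move=> gc /andP[t0 t1]; exists (c @` `[0, l]); first by exists l, c.
have [l0 _ _ _] := gc; exists (t * l) => //=.
by rewrite in_itv/= mulr_ge0//= ler_piMl.
Qed.

Lemma set_dist_lipschitz z z' X : X !=set0 ->
  set_dist z X <= mdist z z' + set_dist z' X.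
Proof.
move=> X0; apply/ler_addgt0Pr => e e0.
have [x Xx xz] := set_dist_approx z' X0 e0.
have := set_dist_le z Xx; have := metric_triangle z z' x; lra.
Qed.

Lemma set_dist_le0 z X : X z -> set_dist z X <= 0.
Proof. by move=> Xz; rewrite -(mdistxx z) set_dist_le. Qed.

(** Choose almost nearest points of X to z1 and z2; the geodesic joining them stays in X and is
    compared with c. *)
Lemma set_dist_geodesic X z1 z2 (l t : R) c : X !=set0 -> geodesically_convex X ->
  geodesic_path mdist z1 z2 l c -> 0 <= t <= 1 ->
  set_dist (c (t * l)) X <= (1 - t) * set_dist z1 X + t * set_dist z2 X.
Proof.
move=> X0 cX gc t01; have [t0 t1] := andP t01; apply/ler_addgt0Pr => e e0.
have [x1 Xx1 h1] := set_dist_approx z1 X0 e0.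
have [x2 Xx2 h2] := set_dist_approx z2 X0 e0.
have [m [g gg]] := hgeodesic x1 x2.
have [S gS Sg] := geodesic_path_segment gg t01.
apply: le_trans (set_dist_le _ (cX _ _ _ Xx1 Xx2 gS _ Sg)) _.
apply: le_trans (convex_metric_two_geodesics gc gg t01) _.
have -> : (1 - t) * set_dist z1 X + t * set_dist z2 X + e =
  (1 - t) * (set_dist z1 X + e) + t * (set_dist z2 X + e) by ring.
by rewrite lerD// ler_wpM2l ?subr_ge0// ltW.
Qed.

Lemma mdist_geodesic y z1 z2 (l t : R) c :
  geodesic_path mdist z1 z2 l c -> 0 <= t <= 1 ->
  mdist (c (t * l)) y <= (1 - t) * mdist z1 y + t * mdist z2 y.
Proof.
move=> gc t01.
have gy : geodesic_path mdist y y 0 (fun=> y).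
  split=> // u u'; rewrite !in_itv /= => /le_anti <- /le_anti <-.
  by rewrite mdistxx subrr normr0.
exact: (convex_metric_two_geodesics gc gy t01).
Qed.

Lemma closure_mdistP X z :
  closure X z <-> forall e, 0 < e -> exists2 x, X x & mdist z x < e.
Proof.
split=> [clX e e0|h B].
  have [|x [Xx zx]] := clX [set x | mdist z x < e]; last by exists x.
  by apply/metricType_numDomainType.nbhs_mdistP; exists e.
move=> /(@metricType_numDomainType.nbhs_mdistP R E)[e /= e0 eB].
by have [x Xx zx] := h _ e0; exists x; split=> //; exact: eB.
Qed.

(* A substitute for the convex hull of X and y, which is hard to control: being a sublevel
   set of a convex function it is convex, and its points at distance almost r from X are
   close to y. *)
Definition drop X y (k r : R) : set E :=
  [set z | set_dist z X + k * mdist z y <= r].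

Lemma drop_convex X y (k r : R) : X !=set0 -> geodesically_convex X -> 0 <= k ->
  geodesically_convex (drop X y k r).
Proof.
move=> X0 cX k0 z1 z2 S; rewrite /drop /= => h1 h2 gS z Sz.
have [l [c [t [gc t01 ->]]]] := geodesic_segmentP gS Sz.
have [t0 t1] := andP t01.
have h3 := set_dist_geodesic X0 cX gc t01.
have h4 := ler_wpM2l k0 (mdist_geodesic y gc t01).
have h5 : (1 - t) * (set_dist z1 X + k * mdist z1 y) <= (1 - t) * r.
  by rewrite ler_wpM2l ?subr_ge0.
have h6 := ler_wpM2l t0 h2.
rewrite /=; lra.
Qed.

Lemma drop_closed X y (k r : R) : X !=set0 -> 0 <= k -> closed (drop X y k r).
Proof.
move=> X0 k0 z /closure_mdistP h; apply/ler_addgt0Pr => e e0.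
have k1 : 0 < 1 + k by lra.
have [x] := h _ (divr_gt0 e0 k1); rewrite /drop /= => hx zx.
have h1 := set_dist_lipschitz z x X0.
have h2 := ler_wpM2l k0 (metric_triangle z x y).
move: zx; rewrite ltr_pdivlMr//; lra.
Qed.

End ConvexMetric.

(** * The distance between two sets *)

Section Lambda.
Context {R : realType} {E : metricType R}.
Implicit Types (X Y : set E) (x y : E).

Lemma lambdaC X Y : lambda X Y = lambda Y X.
Proof.
congr inf; apply/seteqP; split => _ [x [y [Xx Yy ->]]];
  by exists y, x; split=> //; rewrite metric_sym.
Qed.

Lemma lambda_le X Y x y : X x -> Y y -> lambda X Y <= mdist x y.
Proof.
move=> Xx Yy; apply: ge_inf; last by exists x, y.
by exists 0 => _ [u [v [_ _ ->]]]; exact: mdist_ge0.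
Qed.

Lemma lambda_approx X Y (e : R) : X !=set0 -> Y !=set0 -> 0 < e ->
  exists x y, [/\ X x, Y y & mdist x y < lambda X Y + e].
Proof.
move=> [x Xx] [y Yy] e0.
have hi : has_inf [set d | exists x y, [/\ X x, Y y & d = mdist x y]].
  split; first by exists (mdist x y), x, y.
  by exists 0 => _ [u [v [_ _ ->]]]; exact: mdist_ge0.
by have [_ [u [v [Xu Yv ->]]] lt] := inf_adherent e0 hi; exists u, v.
Qed.

End Lambda.

(** * Well-posedness as concentration at every scale *)

Section WellPosedness.
Context {R : realType} {E : metricType R}.
Implicit Types (A X Y : set E) (x y : E).

(* The subtraction of d makes the condition open in X for the Hausdorff distance. *)
Definition concentrated A X (w : R) : Prop :=
  exists q p (d : R), 0 < d /\ forall a x, A a -> X x ->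
    mdist a x <= lambda A X + d -> mdist q a <= w - d /\ mdist p x <= w - d.

Lemma concentrated_le A X (w w' : R) :
  w <= w' -> concentrated A X w -> concentrated A X w'.
Proof.
move=> ww' [q [p [d [d0 hd]]]]; exists q, p, d; split=> // a x Aa Xx ax.
by have [] := hd _ _ Aa Xx ax; split; lra.
Qed.

Lemma minimizing_sequence_bound A X (a x : nat -> E) :
  (forall n, A (a n)) -> (forall n, X (x n)) ->
  (forall n, mdist (a n) (x n) <= lambda A X + n.+1%:R^-1) ->
  minimizing_sequence A X a x.
Proof.
move=> Aa Xx h; split=> //; apply/cvgrPdist_le => e e0.
near=> n.
have n1 : n.+1%:R^-1 <= e by near: n; apply: filterS (near_infty_natSinv_lt (PosNum e0)) => n /ltW.
have := h n; have := lambda_le (Aa n) (Xx n) => h1 h2.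
by rewrite distrC ger0_norm ?subr_ge0// lerBlDl (le_trans h2)// lerD2l.
Unshelve. all: by end_near. Qed.

Lemma minimizing_sequence_exists A X : A !=set0 -> X !=set0 ->
  exists a x : nat -> E, minimizing_sequence A X a x.
Proof.
move=> A0 X0.
have h n : exists ax : E * E,
    [/\ A ax.1, X ax.2 & mdist ax.1 ax.2 <= lambda A X + n.+1%:R^-1].
  have [|a [x [Aa Xx /ltW ax]]] := lambda_approx A0 X0 (_ : 0 < n.+1%:R^-1 :> R).
    by rewrite invr_gt0.
  by exists (a, x).
have [f fP] := choice h.
exists (fun n => (f n).1), (fun n => (f n).2).
by apply: minimizing_sequence_bound => n; have [] := fP n.
Qed.

Lemma minimizing_sequence_near A X (a x : nat -> E) (d : R) :
  minimizing_sequence A X a x -> 0 < d ->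
  \forall n \near \oo, mdist (a n) (x n) <= lambda A X + d.
Proof.
move=> [_ _ /cvgrPdist_le h] /h; apply: filterS => n.
by rewrite ler_norml => /andP[]; lra.
Qed.

Lemma min_solution_unique A X z z' : (forall w : R, 0 < w -> concentrated A X w) ->
  min_solution A X z -> min_solution A X z' -> z = z'.
Proof.
move=> H [Az Xz hz] [Az' Xz' hz'].
have H' (w : R) : 0 < w -> mdist z.1 z'.1 <= w /\ mdist z.2 z'.2 <= w.
  move=> w0; have [q [p [d [d0 hd]]]] := H _ (divr_gt0 w0 (ltr0Sn _ 1)).
  have [|h1 h2] := hd _ _ Az Xz; first by rewrite hz; lra.
  have [|h3 h4] := hd _ _ Az' Xz'; first by rewrite hz'; lra.
  have := metric_triangle z.1 q z'.1; have := metric_triangle z.2 p z'.2.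
  rewrite (metric_sym z.1 q) (metric_sym z.2 p); split; lra.
case: z z' H' {hz hz' Az Xz Az' Xz'} => [a x] [a' x'] /= H'.
congr pair; apply: mdist_positivity; apply/le_anti; rewrite mdist_ge0 andbT;
  by apply/ler_addgt0Pr => w /H'[]; rewrite add0r.
Qed.

Lemma complete_cvg (u : nat -> E) : complete_space E ->
  (forall e : R, 0 < e -> exists q, \forall n \near \oo, mdist q (u n) < e) ->
  exists x, u n @[n --> \oo] --> x.
Proof.
move=> hE hu; apply: (hE (u @ \oo)); apply: cauchy_exP => e /hu[q uq].
by exists q; rewrite ballEmdist.
Qed.

Lemma closed_cvg_seq X (u : nat -> E) x : closed X -> (forall n, X (u n)) ->
  u n @[n --> \oo] --> x -> X x.
Proof.
move=> cX Xu ux; apply: cX => B xB.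
have /filter_ex[n Bun] : \forall n \near \oo, B (u n) by exact: ux.
by exists (u n).
Qed.

(** Concentration at scale e traps the tails of both sequences in balls of radius e, so both are
    Cauchy; A and X being closed, the limits form a solution. *)
Lemma minimizing_sequence_cvg A X (a x : nat -> E) : complete_space E ->
  closed A -> closed X -> (forall w : R, 0 < w -> concentrated A X w) ->
  minimizing_sequence A X a x ->
  exists z, [/\ min_solution A X z, a n @[n --> \oo] --> z.1 &
    x n @[n --> \oo] --> z.2].
Proof.
move=> hE cA cX H ax; have [Aa Xx _] := ax.
have H' (e : R) : 0 < e -> exists q p,
    \forall n \near \oo, mdist q (a n) < e /\ mdist p (x n) < e.
  move=> e0; have [q [p [d [d0 hd]]]] := H e e0; exists q, p.
  apply: filterS (minimizing_sequence_near ax d0) => n.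
  by move=> /(hd _ _ (Aa n) (Xx n))[]; lra.
have [|a0 aa0] := @complete_cvg a hE.
  by move=> e /H'[q [p h]]; exists q; apply: filterS h => n [].
have [|x0 xx0] := @complete_cvg x hE.
  by move=> e /H'[q [p h]]; exists p; apply: filterS h => n [].
exists (a0, x0); split=> //=.
have Aa0 := closed_cvg_seq cA Aa aa0; have Xx0 := closed_cvg_seq cX Xx xx0.
split => //=; apply/le_anti; rewrite (lambda_le Aa0 Xx0) andbT.
apply/ler_addgt0Pr => e e0; have e3 : 0 < e / 3 by lra.
have [n [[h1 h2] h3]] := filter_ex (filterI (filterI
  (metricType_numDomainType.cvgr_dist_lt aa0 e3)
  (metricType_numDomainType.cvgr_dist_lt xx0 e3)) (minimizing_sequence_near ax e3)).
have := metric_triangle a0 (a n) x0; have := metric_triangle (a n) (x n) x0.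
rewrite /= (metric_sym (x n)); lra.
Qed.

(** Forward, a failure of concentration around the solution itself yields a minimizing sequence that
    stays away from it. Backward, every minimizing sequence converges to a solution, and
    concentration makes the solution unique. *)
Lemma min_well_posedP A X : complete_space E ->
  A !=set0 -> closed A -> X !=set0 -> closed X ->
  min_well_posed A X <-> forall w : R, 0 < w -> concentrated A X w.
Proof.
move=> hE A0 cA X0 cX; split=> [[z0 [z0P _ z0cvg]] w w0|H].
  apply: contrapT => Nw.
  (* The bound by 1 / (n + 1) makes the sequence minimizing; the bound [w / 2] gives
     [w / 2 <= w - d n], contradicted once both terms are within [w / 2] of the solution. *)
  pose d n : R := Num.min n.+1%:R^-1 (w / 2).
  have d0 n : 0 < d n by rewrite lt_min invr_gt0 ltr0Sn divr_gt0.
  have h n : exists ax : E * E, [/\ A ax.1, X ax.2,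
      mdist ax.1 ax.2 <= lambda A X + d n &
      ~ (mdist z0.1 ax.1 <= w - d n /\ mdist z0.2 ax.2 <= w - d n)].
    apply: contrapT => Nh; apply: Nw; exists z0.1, z0.2, (d n); split=> // a x Aa Xx ax.
    by apply: contrapT => Nax; apply: Nh; exists (a, x).
  have [f fP] := choice h.
  have [|f1 f2] := z0cvg (fun n => (f n).1) (fun n => (f n).2).
    apply: minimizing_sequence_bound => n; have [? ? h1 _] := fP n => //.
    by apply: le_trans h1 _; rewrite lerD2l ge_min lexx.
  have w2 : 0 < w / 2 by lra.
  have [n [h1 h2]] := filter_ex (filterI
    (metricType_numDomainType.cvgr_dist_lt f1 w2)
    (metricType_numDomainType.cvgr_dist_lt f2 w2)).
  have [_ _ _] := fP n; apply.
  have : d n <= w / 2 by rewrite ge_min lexx orbT.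
  rewrite /= in h1 h2; split; lra.
have [a [x ax]] := minimizing_sequence_exists A0 X0.
have [z0 [z0P _ _]] := minimizing_sequence_cvg hE cA cX H ax.
exists z0; split=> //; first by move=> z zP; exact: min_solution_unique H zP z0P.
move=> a' x' /(minimizing_sequence_cvg hE cA cX H)[z [zP az xz]].
by rewrite (min_solution_unique H z0P zP).
Qed.

End WellPosedness.

(** * Stability under Hausdorff perturbations *)

Section Hausdorff.
Context {R : realType} {E : metricType R}.
Implicit Types (X Y Z : Pbclcv E) (A : set E).

Lemma Pbclcv_nonempty X : (X : set E) !=set0.
Proof. by have [] := Pbclcv_bcl X. Qed.

Lemma set_dist_hausdorff X Y (x : E) : (X : set E) x -> set_dist x Y <= mdist X Y.
Proof.
move=> Xx; rewrite Pbclcv_mdistE le_max.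
by rewrite (set_dist_excess (Pbclcv_bcl X) (Pbclcv_bcl Y) Xx).
Qed.

Lemma hausdorff_approx X Y (x : E) (e : R) : (X : set E) x -> mdist X Y < e ->
  exists2 y, (Y : set E) y & mdist x y < e.
Proof.
move=> Xx XYe; have e0 : 0 < e - mdist X Y by rewrite subr_gt0.
have [y Yy xy] := set_dist_approx x (Pbclcv_nonempty Y) e0.
by exists y => //; have := set_dist_hausdorff Y Xx; lra.
Qed.

Lemma hausdorff_le X Y (r : R) : (X : set E) `<=` Y ->
  (forall y, (Y : set E) y -> set_dist y X <= r) -> mdist X Y <= r.
Proof.
move=> XY h; have bX := Pbclcv_bcl X; have bY := Pbclcv_bcl Y.
rewrite Pbclcv_mdistE ge_max; apply/andP; split; last exact: excess_le.
apply: excess_le => // x Xx; apply: le_trans (set_dist_le0 (XY _ Xx)) _.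
exact: le_trans (set_dist_ge0 x (Pbclcv_nonempty X)) (h _ (XY _ Xx)).
Qed.

Lemma lambda_lipschitz A X Y : A !=set0 -> lambda A Y <= lambda A X + mdist X Y.
Proof.
move=> A0; apply/ler_addgt0Pr => e e0; have e2 : 0 < e / 2 by lra.
have [a [x [Aa Xx ax]]] := lambda_approx A0 (Pbclcv_nonempty X) e2.
have [|y Yy xy] := @hausdorff_approx X Y x (mdist X Y + e / 2) Xx; first by lra.
have := lambda_le Aa Yy; have := metric_triangle a x y; lra.
Qed.

Lemma concentrated_open A X (w : R) : A !=set0 -> concentrated A X w ->
  exists2 r : R, 0 < r & forall Y, mdist X Y < r -> concentrated A Y w.
Proof.
move=> A0 [q [p [d [d0 hd]]]]; have d3 : 0 < d / 3 by lra.
(* Three errors of [d / 3] add up to d: the new tolerance, the change of [lambda], and the passage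
   from y to a nearby x in X. *)
exists (d / 3) => // Y XY; exists q, p, (d / 3); split=> // a y Aa Yy ay.
have YX : mdist Y X < d / 3 by rewrite metric_sym.
have [x Xx yx] := hausdorff_approx Yy YX.
have := lambda_lipschitz X Y A0; have := metric_triangle a y x => h1 h2.
have [|h3 h4] := hd a x Aa Xx; first by lra.
by have := metric_triangle p x y; rewrite (metric_sym x y); split; lra.
Qed.

End Hausdorff.

(** * Density of the well-posed problems *)

Section Density.
Context {R : realType} {E : metricType R} (kappa : R).
Hypothesis hcomplete : complete_space E.
Hypothesis hgeodesic : geodesic_space E.
Hypothesis hconvex : convex_metric E.
Hypothesis kappa_lt0 : kappa < 0.
Hypothesis hcurv : curvature_bounded_below E kappa.
Context (A : set E) (hA : Pbcl A).
Implicit Types X Y Z : Pbclcv E.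

Let A_nonempty : A !=set0. Proof. by case: hA. Qed.

Lemma drop_perturbation X (w r : R) : 0 < w -> 0 < r -> r < lambda A X ->
  exists Y, [/\ (X : set E) `<=` Y, mdist X Y <= r & concentrated A Y w].
Proof.
move=> w0 r0 rl.
have [X0 [M XM] _] := Pbclcv_bcl X.
have M0 : 0 <= M by have [x Xx] := X0; rewrite -(mdistxx x) XM.
(* X has diameter at most M and y is at distance r from x in X, so [k * (M + r) = r] puts X inside
   the [drop]. *)
pose k := r / (M + r).
have k0 : 0 < k by rewrite divr_gt0//; lra.
have w2 : 0 < w / 2 by lra.
have [e e0 he] := geodesic_nonbranching hgeodesic kappa_lt0 hcurv (lambda A X + 1) r0 w2.
pose K := 2 + 2 / k.
have K2 : 2 < K by rewrite ltrDl divr_gt0.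
(* In turn: d(x, a) <= lambda + 1; [w / 2 <= w - d]; the errors d and d + 2 d / k in the
   non-branching lemma are at most e; and 2 d / k <= w / 2. *)
pose d := Num.min (Num.min 1 (w / 2)) (Num.min (e / K) (k * w / 4)).
have K0 : 0 < K by exact: lt_trans K2.
have kw4 : 0 < k * w / 4 by rewrite divr_gt0// mulr_gt0.
have d0 : 0 < d by rewrite !lt_min ltr01 w2 kw4 divr_gt0.
have : d <= d by []; rewrite {2}/d !le_min => /andP[/andP[d1 dw] /andP[deK dkw]].
have dKe : d * K <= e by rewrite -ler_pdivlMr.
have [a [x [Aa Xx ax]]] := lambda_approx A_nonempty X0 d0.
have lax := lambda_le Aa Xx.
have xaE : mdist x a = mdist a x by exact: metric_sym.
have [l [c gc]] := hgeodesic x a.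
move: (gc); rewrite (geodesic_length gc) => {}gc {l}.
have [_ c0 ca cd] := gc.
pose y := c r.
have ry : 0 <= r <= mdist x a by apply/andP; split; lra.
have yx : mdist y x = r.
  by rewrite -[in LHS]c0 cd ?in_itv//= ?lexx ?mdist_ge0// subr0 ger0_norm// ltW.
have ya : mdist y a = mdist x a - r.
  rewrite -[in LHS]ca cd ?in_itv//= ?lexx ?mdist_ge0// distrC ger0_norm// subr_ge0.
  by case/andP: ry.
have kM : k * (M + r) = r by rewrite divfK//; lra.
have yX : set_dist y X <= r by rewrite -yx; exact: set_dist_le.
have Yy : drop X y k r y by rewrite /drop /= mdistxx mulr0 addr0.
have XY : (X : set E) `<=` drop X y k r.
  move=> x' Xx'; rewrite /drop /=.
  have := set_dist_le0 Xx'; have := metric_triangle x' x y.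
  have := XM _ _ Xx' Xx; rewrite (metric_sym x y) yx => h1 h2 h3.
  have : k * mdist x' y <= k * (M + r) by rewrite ler_pM2l//; lra.
  lra.
have YX z : drop X y k r z -> set_dist z X <= r.
  rewrite /drop /=; have := mulr_ge0 (ltW k0) (mdist_ge0 z y); lra.
have bY : Pbcl (drop X y k r).
  split; first by exists y.
  - have near z : drop X y k r z -> exists2 x', (X : set E) x' & mdist z x' < r + 1.
      move=> /YX zX; have [x' Xx' zx'] := set_dist_approx z X0 (@ltr01 R).
      by exists x' => //; lra.
    exists (M + (r + 1) *+ 2) => z z' /near[x1 Xx1 h1] /near[x2 Xx2 h2].
    have := XM _ _ Xx1 Xx2; have := metric_triangle z x1 z'.
    have := metric_triangle x1 x2 z'; rewrite (metric_sym x2 z'); lra.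
  - exact: drop_closed (ltW k0).
have cY : geodesically_convex (drop X y k r).
  exact: (drop_convex hgeodesic hconvex X0 (@Pbclcv_convex _ _ X) (ltW k0)).
pose Y := MkPbclcv bY cY.
exists Y; split=> //; first exact: hausdorff_le.
exists a, y, d; split=> // a' y' Aa' Yy' ay'.
have lY : lambda A Y <= mdist x a - r by rewrite -ya metric_sym lambda_le.
have y'X : lambda A X - mdist a' y' <= set_dist y' X.
  apply/ler_addgt0Pr => t t0.
  have [x' Xx' y'x'] := set_dist_approx y' X0 t0.
  have := lambda_le Aa' Xx'; have := metric_triangle a' y' x'; lra.
(* As d(a', y') <= d(x, a) - r + d < lambda - r + 2 d, the distance from y' to X exceeds r - 2 d,
   and the definition of [drop] leaves less than 2 d for the other term. *)
have ky' : k * mdist y' y <= d *+ 2.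
  by have : set_dist y' X + k * mdist y' y <= r := Yy'; lra.
have y'y : mdist y' y <= d * (2 / k).
  by rewrite mulrA ler_pdivlMr// mulrC; lra.
have dK : d * K = d * 2 + d * (2 / k) by rewrite mulrDr.
have aa' : mdist a a' <= w / 2.
  apply: (he x a a' c) => //.
  - by apply/andP; split; lra.
  - by have := lambda_le Aa' Xx; rewrite (metric_sym a' x); nra.
  - rewrite -/y; have := metric_triangle y y' a'.
    rewrite (metric_sym y y') (metric_sym y' a'); lra.
split; first lra.
rewrite metric_sym.
have : d * (2 / k) <= w / 2.
  by rewrite mulrA ler_pdivrMr//; lra.
lra.
Qed.

(** Step of a nested-ball construction: the ball of radius r' about Y lies in the ball of radius r
    about X, and all its members are concentrated at scale w. *)
Lemma drop_step X (w r : R) : 0 < w -> 0 < r < lambda A X ->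
  exists Y r', [/\ (X : set E) `<=` Y, mdist X Y <= r - r', 0 < r' < lambda A Y &
    forall Z, mdist Y Z <= r' -> concentrated A Z w].
Proof.
move=> w0 /andP[r0 rl]; have r2 : 0 < r / 2 by lra.
have [|Y [XY dXY cY]] := @drop_perturbation X w (r / 2) w0 r2; first by lra.
have [t t0 ht] := concentrated_open A_nonempty cY.
have := lambda_lipschitz Y X A_nonempty; rewrite (metric_sym Y X) => hl.
have lY : 0 < lambda A Y by lra.
(* The perturbation uses [r / 2] and r' is at most [r / 4], which leaves [r / 2 <= r - r']. The
   final halving makes the comparisons with t and [lambda A Y] strict. *)
pose r' : R := Num.min (r / 2) (Num.min t (lambda A Y)) / 2.
have r'0 : 0 < r' by rewrite divr_gt0// !lt_min r2 t0.
have : r' * 2 <= Num.min (r / 2) (Num.min t (lambda A Y)) by rewrite divfK.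
rewrite !le_min => /and3P[h1 h2 h3].
exists Y, r'; split=> //; [lra|by apply/andP; split; lra|].
by move=> Z YZ; apply: ht; lra.
Qed.

(** Two points of the closure are within e of a common [X n], by monotonicity; the distance to this
    convex set is a convex function, so it stays below e along any geodesic between them. *)
Lemma Pbclcv_increasing_union (X : nat -> Pbclcv E) (r : R) :
  (forall n, (X n : set E) `<=` X n.+1) -> (forall n, mdist (X 0%N) (X n) <= r) ->
  exists Z : Pbclcv E, (Z : set E) = closure (\bigcup_n (X n : set E)).
Proof.
move=> Xinc Xr.
have Xle n m : (n <= m)%N -> (X n : set E) `<=` X m.
  move=> /subnK <-; elim: (m - n)%N => [//|j IH].
  exact: subset_trans IH (Xinc _).
set Z := closure _.
have approx z (e : R) : Z z -> 0 < e -> exists n x, (X n : set E) x /\ mdist z x < e.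
  by move=> /closure_mdistP h /h[x [n _ Xx] zx]; exists n, x.
have r0 : 0 <= r := le_trans (mdist_ge0 _ _) (Xr 0%N).
have bZ : Pbcl Z.
  split; last exact: closed_closure.
    have [x Xx] := Pbclcv_nonempty (X 0%N).
    by exists x; apply: subset_closure; exists 0%N.
  have [_ [M XM] _] := Pbclcv_bcl (X 0%N).
  have near0 z : Z z -> exists2 x, (X 0%N : set E) x & mdist z x < r + 2.
    move=> Zz; have [n [x [Xx zx]]] := approx z 1 Zz ltr01.
    have [|x0 X0x0 xx0] := @hausdorff_approx _ _ (X n) (X 0%N) x (r + 1) Xx.
      by rewrite metric_sym; have := Xr n; lra.
    by exists x0 => //; have := metric_triangle z x x0; lra.
  exists (M + (r + 2) + (r + 2)) => z z' /near0[x Xx zx] /near0[x' Xx' zx'].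
  have := XM _ _ Xx Xx'; have := metric_triangle z x z'.
  have := metric_triangle x x' z'; rewrite (metric_sym x' z'); lra.
suff cZ : geodesically_convex Z by exists (MkPbclcv bZ cZ).
move=> z1 z2 S Zz1 Zz2 gS z Sz; apply/closure_mdistP => e e0.
have [l [c [t [gc t01 ->]]]] := geodesic_segmentP gS Sz.
have [n1 [x1 [Xx1 h1]]] := approx _ _ Zz1 e0.
have [n2 [x2 [Xx2 h2]]] := approx _ _ Zz2 e0.
set n := maxn n1 n2.
have {}Xx1 := Xle n1 n (leq_maxl _ _) _ Xx1.
have {}Xx2 := Xle n2 n (leq_maxr _ _) _ Xx2.
have h := set_dist_geodesic hgeodesic hconvex (Pbclcv_nonempty (X n))
  (@Pbclcv_convex _ _ (X n)) gc t01.
have g1 := le_lt_trans (set_dist_le z1 Xx1) h1.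
have g2 := le_lt_trans (set_dist_le z2 Xx2) h2.
have he : set_dist (c (t * l)) (X n) < e.
  pose m : R := Num.max (set_dist z1 (X n)) (set_dist z2 (X n)).
  have me : m < e by rewrite gt_max g1 g2.
  have [t0 t1] := andP t01; apply: le_lt_trans h _; apply: le_lt_trans me.
  have -> : m = (1 - t) * m + t * m by ring.
  by rewrite lerD// ler_wpM2l ?subr_ge0// le_max lexx ?orbT.
have e' : 0 < e - set_dist (c (t * l)) (X n) by rewrite subr_gt0.
have [x Xx zx] := set_dist_approx (c (t * l)) (Pbclcv_nonempty (X n)) e'.
by exists x; [exists n|lra].
Qed.

Lemma min_well_posed_near X (r : R) : 0 < r < lambda A X ->
  exists Z, [/\ mdist X Z <= r, 0 < lambda A Z & min_well_posed A Z].
Proof.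
move=> rX.
(* The invariant required by [drop_step] is carried in the type, so that a choice function can be
   iterated. *)
pose state := {p : Pbclcv E * R | 0 < p.2 < lambda A p.1}.
have step (np : nat * state) : exists q : state,
    [/\ ((val np.2).1 : set E) `<=` (val q).1,
      mdist (val np.2).1 (val q).1 <= (val np.2).2 - (val q).2 &
      forall Z, mdist (val q).1 Z <= (val q).2 -> concentrated A Z np.1.+1%:R^-1].
  case: np => n [[Y t] /= tY].
  have [|Y' [t' [h1 h2 h3 h4]]] := @drop_step Y n.+1%:R^-1 t _ tY.
    by rewrite invr_gt0.
  by exists (exist _ (Y', t') h3).
have [f fP] := choice step.
pose u := fix u n : state :=
  if n is m.+1 then f (m, u m) else exist _ (X, r) rX.
pose Xn n := (val (u n)).1; pose rn n := (val (u n)).2.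
have Xinc n : (Xn n : set E) `<=` Xn n.+1 by have [] := fP (n, u n).
have Xd n : mdist (Xn n) (Xn n.+1) <= rn n - rn n.+1 by have [] := fP (n, u n).
(* Step n produces the ball of index n + 1, whose members are concentrated at scale 1 / (n + 1). *)
have Xc n Z : mdist (Xn n.+1) Z <= rn n.+1 -> concentrated A Z n.+1%:R^-1.
  by have [_ _] := fP (n, u n); exact.
have rn0 n : 0 < rn n by have /andP[] := valP (u n).
have Xball n j : mdist (Xn n) (Xn (j + n)%N) <= rn n - rn (j + n)%N.
  elim: j => [|j IH]; first by rewrite mdistxx subrr.
  by have := metric_triangle (Xn n) (Xn (j + n)%N) (Xn (j + n).+1);
    have := Xd (j + n)%N; rewrite addSn; lra.
have Xle n j : (Xn n : set E) `<=` Xn (j + n)%N.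
  elim: j => [//|j IH]; exact: subset_trans IH (Xinc _).
have [|Z ZE] := @Pbclcv_increasing_union Xn r Xinc.
  by move=> n; have := Xball 0%N n; have := rn0 n; rewrite addn0 {2}/rn /=; lra.
(* The distances telescope, so every later set is within [rn n] of [Xn n]; thus Z lies in all the
   balls. *)
have XZ n : mdist (Xn n) Z <= rn n.
  apply: hausdorff_le => [x Xx|z].
    by rewrite ZE; apply: subset_closure; exists n.
  rewrite ZE => /closure_mdistP h; apply/ler_addgt0Pr => e /h[x [j _ Xx] zx].
  have {}Xx : (Xn (j + n)%N : set E) x by rewrite addnC; exact: Xle Xx.
  have := set_dist_lipschitz z x (Pbclcv_nonempty (Xn n)).
  have := set_dist_hausdorff (Xn n) Xx; rewrite (metric_sym (Xn (j + n)%N)).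
  have := Xball n j; have := rn0 (j + n)%N; lra.
have {}XZ0 : mdist X Z <= r := XZ 0%N.
exists Z; split=> //.
  have := lambda_lipschitz Z X A_nonempty; rewrite metric_sym.
  by have /andP[_] := rX; lra.
have [_ _ cA] := hA; have [Z0 _ cZ] := Pbclcv_bcl Z.
apply/min_well_posedP => // w w0.
have [n] := ltr_add_invr w0; rewrite add0r => nw.
exact: concentrated_le (ltW nw) (Xc n Z (XZ n.+1)).
Qed.

End Density.

(** * Density and the G_delta property in the closure *)

Theorem theorem3p3 (R : realType) (E : metricType R) (kappa : R)
  (hcomplete : complete_space E) (hgeodesic : geodesic_space E)
  (hconvex : convex_metric E) (hkappa : kappa < 0)
  (hcurv : curvature_bounded_below E kappa)
  (A : set E) (hA : Pbcl A) :
  dense (Wmin A) /\ Gdelta (Wmin A).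
Proof.
have [A0 _ cA] := hA; split.
  move=> U [X UX] [V oV UV].
  have VX : V (set_val X) by move: UX; rewrite -UV.
  have clX : PbclcvA A (set_val X) := set_valP X.
  (* [lambda] may vanish at X itself, so X is first replaced by a set in V with positive
     [lambda]. *)
  have [X0 [lX0 VX0]] := clX _ (open_nbhs_nbhs (conj oV VX)).
  rewrite /= lambdaC in lX0.
  have /(@metricType_numDomainType.nbhs_mdistP R (Pbclcv E))[e /= e0 eV] :=
    open_nbhs_nbhs (conj oV VX0).
  pose r : R := Num.min e (lambda A X0) / 2.
  have r0 : 0 < r by rewrite divr_gt0// lt_min e0.
  have : r * 2 <= Num.min e (lambda A X0) by rewrite divfK.
  rewrite le_min => /andP[re rl].
  have [|Z [XZ lZ wZ]] := min_well_posed_near hcomplete hgeodesic hconvex hkappa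
    hcurv hA (X := X0) (r := r); first by apply/andP; split; lra.
  have PZ : Z \in PbclcvA A by rewrite inE; apply: subset_closure; rewrite /= lambdaC.
  exists (SigSub PZ); split; last by rewrite /Wmin /= set_valE.
  by rewrite -UV /= set_valE /=; apply: eV => /=; lra.
(* The scales 1 / (n + 1) suffice because [concentrated] is monotone in w; each [F n] is the trace
   of an open set. *)
pose F (n : nat) : set (PbclcvA A) :=
  set_val @^-1` [set X : Pbclcv E | concentrated A X n.+1%:R^-1].
exists F => [n|].
  exists [set X : Pbclcv E | concentrated A X n.+1%:R^-1] => //.
  rewrite openE => X /= /(concentrated_open A0)[r r0 hr].
  by apply/(@metricType_numDomainType.nbhs_mdistP R (Pbclcv E)); exists r.
apply/seteqP; split=> X.
  have [X0 _ cX] := Pbclcv_bcl (set_val X : Pbclcv E).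
  move=> /(min_well_posedP hcomplete A0 cA X0 cX) h n _.
  by apply: h; rewrite invr_gt0.
have [X0 _ cX] := Pbclcv_bcl (set_val X : Pbclcv E).
move=> h; apply/min_well_posedP => // w w0.
have [n] := ltr_add_invr w0; rewrite add0r => nw.
exact: concentrated_le (ltW nw) (h n I).
Qed.
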